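(* Let $q\ge 4$ be an even integer (and $p=1$), and let $N^{-}(s)$ be the number of eigenvalues, counted with multiplicity, in $[-s,0)$ of $\Box=-\Delta_x+\Delta_y$ on $S^1\times S^q$ ($x\in S^1$, $y\in S^q$); that is, $$N^{-}(s)=\sum_{\substack{j\in\mathbb{Z},\ k\in\mathbb{Z}_{\ge 0}\\ 0<k(k+q-1)-j^2\le s}}\frac{2k+q-1}{q-1}\binom{k+q-2}{k}.$$ Then, as $s\to\infty$, $$N^{-}(s)=\frac{4}{q!}\,(1-2^{-q})\,\zeta(q)\,s^{q}+O(s^{q-1}).$$
   Context: $\Delta_x,\Delta_y$ are the (nonpositive) Laplacians on $S^1=\mathbb{R}/2\pi\mathbb{Z}$ and on the standard unit sphere $S^q$. The eigenfunctions of $\Box$ are $e^{ijx}Y_k^q(y)$, $j\in\mathbb{Z}$, with $Y_k^q$ a spherical harmonic of degree $k\ge 0$ on $S^q$; the eigenvalue is $j^2-k(k+q-1)$, and the space of spherical harmonics of degree $k$ on $S^q$ has dimension $\frac{2k+q-1}{q-1}\binom{k+q-2}{k}$. $\zeta$ is the Riemann zeta function. The integer $q$ is fixed; the implied constant may depend on $q$. *)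

(* Defs.v *)
From mathcomp Require Import all_boot all_order all_algebra.
From mathcomp Require Import all_classical all_reals all_analysis.

Set Implicit Arguments.
Unset Strict Implicit.
Unset Printing Implicit Defensive.

Import Order.TTheory GRing.Theory Num.Theory.
Import numFieldNormedType.Exports.

Local Open Scope classical_set_scope.
Local Open Scope ring_scope.

(* Eigenvalue of Box = - Delta_x + Delta_y on S^1 x S^q for the eigenfunctions
   e^{ijx} Y(y), with Y a spherical harmonic of degree k; the Laplacians are
   nonpositive. *)
Definition box_eigenvalue (q : nat) (j : int) (k : nat) : int :=
  j ^+ 2 - (k * (k + q - 1))%N%:Z.

(* Dimension of the space of spherical harmonics of degree k on S^q, q >= 2;
   the truncated subtractions on nat are then exact. *)
Definition harmonic_dim (R : realType) (q k : nat) : R :=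
  (2 * k + q - 1)%N%:R / (q - 1)%N%:R * 'C(k + q - 2, k)%:R.

Definition neg_modes (R : realType) (q : nat) (s : R) : set (int * nat) :=
  [set jk | - s <= (box_eigenvalue q jk.1 jk.2)%:~R /\
            box_eigenvalue q jk.1 jk.2 < 0].

(* The supremum of the finite partial sums: an infinite family of modes would
   give +oo, not a default value. *)
Definition Nminus (R : realType) (q : nat) (s : R) : \bar R :=
  \esum_(jk in neg_modes q s) (harmonic_dim R q jk.2)%:E.

(* Riemann zeta function on the real half-line x > 1, where its Dirichlet
   series converges. *)
Definition zeta (R : realType) (x : R) : R :=
  limn (fun m : nat => \sum_(1 <= n < m) (n%:R : R) `^ (- x)).

(* Needed by the Landau notations; the library declares the filter instance
   only as a type class. *)
Canonical pinfty_filter_on (R : numFieldType) :=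
  FilterType (pinfty_nbhs R) _.

(* Main.v *)
Require Import Defs.
From mathcomp Require Import all_boot all_order all_algebra.
From mathcomp Require Import all_classical all_reals all_analysis.
From mathcomp Require Import ring lra zify.
Import Order.TTheory GRing.Theory Num.Theory.
Import numFieldNormedType.Exports.
Local Open Scope classical_set_scope.
Local Open Scope ring_scope.

(** The eigenvalues are counted as lattice points under a hyperbola.  With
    [n = 2 k + q - 1], which is odd since [q] is even, completing the square
    turns [0 < k (k + q - 1) - j^2 <= s] into
    [(q - 1)^2 < a b <= X] where [a = n - 2 |j|], [b = n + 2 |j|] and
    [X = 4 s + (q - 1)^2].  Here [a] runs over all odd positive integers, and
    for fixed [a] the number [b] runs over [a], [a + 4], [a + 8], ...
    ([neg_modesE], [Nminus_finsum]).

    A mode has multiplicity [n^(q-1) / (2^(q-2) (q-1)!) + O(n^(q-2))]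
    ([harmonic_dim_estimate], [mode_dim_estimate]).  For fixed [a] the sum of
    [n^(q-1)] over [b <= X / a] is, by telescoping ([row_estimate]),
    [(X / (2 a))^q / q + O(a (X / a)^(q-1))]; the sum of [n^(q-2)] is
    [O((X / a)^(q-1))] ([row_bound]).  Since [q >= 4], the errors
    [X^(q-1) / a^(q-2)] are summable over [a], while the main terms sum to a
    multiple of [X^q] times the sum of [a^(-q)] over odd [a], which is
    [(1 - 2^(-q)) zeta(q)] ([cvg_odd_zeta]).  The hyperbola being followed
    along one family of rows, the points with [a > b] are reached through the
    sign of [j], and no tail of the zeta series is ever cut off: the row
    estimate holds for every [a], empty rows included, so the finite range of
    [a] can simply be enlarged indefinitely ([Nminus_estimate]).  Finally
    [X^q - (4 s)^q = O(s^(q-1))] ([Nminus_asymptotic]). *)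

Set Implicit Arguments.
Unset Strict Implicit.
Unset Printing Implicit Defensive.

(** * Power sums along a progression *)

Section PowerSums.
Variable R : archiRealFieldType.
Implicit Types (a x y Y : R) (e J L : nat).

Lemma exprB_le x y e : 0 <= y <= x ->
  x ^+ e.+1 - y ^+ e.+1 <= e.+1%:R * (x - y) * x ^+ e.
Proof.
case/andP=> y0 yx; rewrite subrXX.
rewrite [X in _ <= X](_ : _ = (x - y) * (\sum_(i < e.+1) x ^+ e)); last first.
  by rewrite sumr_const card_ord -[x ^+ e *+ _]mulr_natl mulrA [_ * (x - y)]mulrC.
apply: ler_wpM2l; first by rewrite subr_ge0.
apply: ler_sum => i _; rewrite /= -[in leRHS](subnK (ltnSE (ltn_ord i))) exprD.
have x0 := le_trans y0 yx.
by apply: ler_wpM2l; [exact: exprn_ge0|rewrite lerXn2r ?nnegrE].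
Qed.

Lemma exprB_ge x y e : 0 <= y <= x ->
  e.+1%:R * (x - y) * y ^+ e <= x ^+ e.+1 - y ^+ e.+1.
Proof.
case/andP=> y0 yx; rewrite subrXX.
rewrite [X in X <= _](_ : _ = (x - y) * (\sum_(i < e.+1) y ^+ e)); last first.
  by rewrite sumr_const card_ord -[y ^+ e *+ _]mulr_natl mulrA [_ * (x - y)]mulrC.
apply: ler_wpM2l; first by rewrite subr_ge0.
apply: ler_sum => i _; rewrite /= -[in leLHS](subnK (ltnSE (ltn_ord i))) exprD.
have x0 := le_trans y0 yx.
by apply: ler_wpM2r; [exact: exprn_ge0|rewrite lerXn2r ?nnegrE].
Qed.

(** Since [2 (e+1) n^e] lies between [n^(e+1) - (n-2)^(e+1)] and
    [(n+2)^(e+1) - n^(e+1)], a sum of [e]-th powers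
    along a progression of step 2 is squeezed by telescoping, with no integral
    comparison. *)
Lemma progression_sum_le a e J : 0 <= a ->
  e.+1%:R * (\sum_(j < J) 2 * (a + 2 * j%:R) ^+ e)
    <= (a + 2 * J%:R) ^+ e.+1 - a ^+ e.+1.
Proof.
move=> a0; elim: J => [|J IH]; first by rewrite big_ord0 !mulr0 addr0 subrr.
rewrite big_ord_recr /= mulrDr.
have J0 : 0 <= J%:R :> R by [].
have := @exprB_ge (a + 2 * J.+1%:R) (a + 2 * J%:R) e.
rewrite -natr1 => /(_ ltac:(lra)).
by rewrite [_ - (a + 2 * J%:R)](_ : _ = 2) -?mulrA; lra.
Qed.

Lemma progression_sum_ge a e J : 0 <= a ->
  (a + 2 * J%:R) ^+ e.+1 - a ^+ e.+1
    <= e.+1%:R * (\sum_(j < J) 2 * (a + 2 * j.+1%:R) ^+ e).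
Proof.
move=> a0; elim: J => [|J IH]; first by rewrite big_ord0 !mulr0 addr0 subrr.
rewrite big_ord_recr /= mulrDr.
have J0 : 0 <= J%:R :> R by [].
have := @exprB_le (a + 2 * J.+1%:R) (a + 2 * J%:R) e.
rewrite -natr1 => /(_ ltac:(lra)).
by rewrite [_ - (a + 2 * J%:R)](_ : _ = 2) -?mulrA; lra.
Qed.

(** Number of integers with absolute value [j]. *)
Definition freq_mult (j : nat) : nat := (0 < j).+1.

Lemma row_truncation a Y L (F : nat -> R) : a <= Y -> 0 <= a -> Y < L%:R ->
  exists J : nat, a + 4 * J%:R <= Y < a + 4 * J%:R + 4 /\
   \sum_(j < L | a + 4 * j%:R <= Y) F j = \sum_(j < J.+1) F j.
Proof.
move=> aY a0 YL; set z := (Y - a) / 4.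
have z0 : 0 <= z by rewrite /z; lra.
have eqz (j : nat) : (a + 4 * j%:R <= Y) = (j <= Num.truncn z)%N.
  by rewrite truncn_ge_nat// /z; apply/idP/idP; lra.
exists (Num.truncn z); split.
  rewrite eqz leqnn /=; move: (truncnS_gt z); rewrite -natr1 /z; lra.
rewrite (big_ord_widen L (fun j => F j)); last first.
  rewrite -(ltr_nat R); apply: le_lt_trans YL.
  have : a + 4 * (Num.truncn z)%:R <= Y by rewrite eqz.
  by have : 0 <= (Num.truncn z)%:R :> R by []; lra.
by apply: eq_bigl => j; rewrite eqz ltnS.
Qed.

Lemma empty_row a Y L : Y < a ->
  (fun j : 'I_L => a + 4 * j%:R <= Y) =1 xpred0.
Proof.
move=> Ya j; apply/negbTE; rewrite -ltNge.
by have : 0 <= j%:R :> R by []; lra.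
Qed.

Lemma weighted_progression_le a e J : 0 <= a ->
  \sum_(j < J) (freq_mult j)%:R * (a + 2 * j%:R) ^+ e
    <= (a + 2 * J%:R) ^+ e.+1 / e.+1%:R.
Proof.
move=> a0; rewrite ler_pdivlMr ?ltr0n// [leLHS]mulrC.
apply: (@le_trans _ _ ((a + 2 * J%:R) ^+ e.+1 - a ^+ e.+1)); last first.
  by rewrite gerBl exprn_ge0.
apply: le_trans (progression_sum_le e J a0).
apply: ler_wpM2l => //; apply: ler_sum => j _.
apply: ler_wpM2r; first by rewrite exprn_ge0// addr_ge0// mulr_ge0.
by rewrite ler_nat /freq_mult; case: (0 < j)%N.
Qed.

(** The term [j = 0] is counted once and not twice; dropping it altogether
    only shifts the progression by one step, which still bounds the sum from
    below. *)
Lemma weighted_progression_ge a e J : 0 <= a ->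
  ((a + 2 * J%:R) ^+ e.+1 - a ^+ e.+1) / e.+1%:R <=
  \sum_(j < J.+1) (freq_mult j)%:R * (a + 2 * j%:R) ^+ e.
Proof.
move=> a0; rewrite ler_pdivrMr ?ltr0n// [leRHS]mulrC.
apply: le_trans (progression_sum_ge e J a0) _.
apply: ler_wpM2l => //; rewrite [X in _ <= X]big_ord_recl /=.
rewrite lerDr mulr_ge0// exprn_ge0// mulr0 addr0//.
Qed.

(** The crude bound is what the lower-order part of the multiplicities needs;
    a nonempty row has [a <= Y], so that its largest [a + 2 j] is less than
    a constant times [Y]. *)
Lemma row_bound a Y e L : 1 <= a -> 0 <= Y < L%:R ->
  \sum_(j < L | a + 4 * j%:R <= Y) (freq_mult j)%:R * (a + 2 * j%:R) ^+ e
    <= 3 ^+ e.+1 * Y ^+ e.+1.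
Proof.
move=> a1 /andP[Y0 YL]; have [aY|Ya] := leP a Y; last first.
  by rewrite (big_pred0 _ _ _ _ (empty_row Ya)) mulr_ge0 ?exprn_ge0.
have a0 : 0 <= a by lra.
have [J [/andP[J1 J2] -> /=]] :=
  row_truncation (fun j => (freq_mult j)%:R * (a + 2 * j%:R) ^+ e) aY a0 YL.
apply: le_trans (weighted_progression_le _ _ a0) _.
have J0 : 0 <= J%:R :> R by [].
rewrite ler_pdivrMr ?ltr0n// -exprMn -[X in X <= _]mulr1.
apply: ler_pM; rewrite ?ler1n//.
- by rewrite exprn_ge0 // -natr1; lra.
- by rewrite lerXn2r ?nnegrE -?natr1; lra.
Qed.

(** On a row the values [n = a + 2 j] run from [a] to about [(a + Y) / 2], and
    each counts twice, so the sum is about [((a + Y) / 2)^(e+1) / (e+1)].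
    Replacing [(a + Y) / 2] by [Y / 2] and rounding the last index changes the
    base by [O(a)], whence the error [O(a Y^e)].  When [Y < a] the row is empty
    and the main term is itself within the error, so the estimate is uniform in
    [a]: the tail of the zeta series needs no separate treatment. *)
Lemma row_estimate a Y e L : 1 <= a -> 0 <= Y < L%:R ->
  `|\sum_(j < L | a + 4 * j%:R <= Y) (freq_mult j)%:R * (a + 2 * j%:R) ^+ e
    - (Y / 2) ^+ e.+1 / e.+1%:R| <= 3 ^+ e.+1 * (a * Y ^+ e).
Proof.
move=> a1 /andP[Y0 YL].
have e0 : 0 < e.+1%:R :> R by rewrite ltr0n.
have Ye0 : 0 <= Y ^+ e by exact: exprn_ge0.
have pow3 : 3 <= 3 ^+ e.+1 :> R.
  by rewrite exprS ler_peMr// exprn_ege1//; lra.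
have small : (Y / 2) ^+ e <= Y ^+ e by rewrite lerXn2r ?nnegrE//; lra.
have [aY|Ya] := leP a Y; last first.
  rewrite (big_pred0 _ _ _ _ (empty_row Ya)) sub0r normrN ger0_norm; last first.
    by rewrite divr_ge0// exprn_ge0//; lra.
  rewrite ler_pdivrMr// exprS [leRHS]mulrAC.
  apply: (@le_trans _ _ (a * Y ^+ e)).
    by apply: ler_pM => //; try lra; rewrite exprn_ge0//; lra.
  rewrite ler_peMl ?mulr_ge0//; first lra.
  by rewrite mulr_ege1 ?ler1n//; lra.
have a0 : 0 <= a by lra.
have [J [/andP[J1 J2] -> /=]] :=
  row_truncation (fun j => (freq_mult j)%:R * (a + 2 * j%:R) ^+ e) aY a0 YL.
have J0 : 0 <= J%:R :> R by [].
rewrite ler_norml; apply/andP; split.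
(* The last index satisfies [Y / 2 - 2 < a + 2 J]. *)
- apply: (@le_trans _ _ (((a + 2 * J%:R) ^+ e.+1 - a ^+ e.+1) / e.+1%:R
     - (Y / 2) ^+ e.+1 / e.+1%:R)); last first.
    by rewrite lerD2r; exact: weighted_progression_ge.
  have main : (Y / 2) ^+ e.+1 - (a + 2 * J%:R) ^+ e.+1 <= e.+1%:R * (2 * Y ^+ e).
    have [lt|ge] := ltP (a + 2 * J%:R) (Y / 2); last first.
      apply: (@le_trans _ _ 0); last by rewrite !mulr_ge0.
      by rewrite subr_le0 lerXn2r ?nnegrE//; lra.
    apply: le_trans (exprB_le _ _) _; first by apply/andP; split; lra.
    rewrite -mulrA; apply: ler_wpM2l => //; apply: ler_pM => //; try lra.
    by rewrite exprn_ge0//; lra.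
  have diag : a ^+ e.+1 <= e.+1%:R * (a * Y ^+ e).
    rewrite exprS; apply: (@le_trans _ _ (a * Y ^+ e)).
      by apply: ler_wpM2l => //; rewrite lerXn2r ?nnegrE//; lra.
    by rewrite ler_peMl ?ler1n// mulr_ge0.
  rewrite -mulrBl lerNl -mulNr ler_pdivrMr//.
  apply: (@le_trans _ _ (e.+1%:R * (3 * (a * Y ^+ e)))).
    have : e.+1%:R * (2 * Y ^+ e) <= e.+1%:R * (2 * (a * Y ^+ e)).
      by apply: ler_wpM2l => //; apply: ler_wpM2l => //; rewrite ler_peMl.
    lra.
  rewrite mulrC; apply: ler_wpM2r => //; apply: ler_wpM2r => //.
  by rewrite mulr_ge0.
(* [a + 2 (J + 1) <= (a + Y) / 2 + 2], and [a / 2 + 2 <= 5 a / 2] as [1 <= a]. *)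
- apply: (@le_trans _ _ (((Y / 2 + 5 / 2 * a) ^+ e.+1 - (Y / 2) ^+ e.+1) / e.+1%:R)).
    rewrite mulrBl lerD2r; apply: le_trans (weighted_progression_le _ _ a0) _.
    have JS : J.+1%:R = J%:R + 1 :> R by rewrite natr1.
    by rewrite ler_wpM2r ?invr_ge0// lerXn2r ?nnegrE; lra.
  rewrite ler_pdivrMr//; apply: le_trans (exprB_le _ _) _; first lra.
  rewrite [_ - Y / 2](_ : _ = 5 / 2 * a); last by ring.
  rewrite -mulrA [leRHS]mulrC; apply: ler_wpM2l => //.
  rewrite [leRHS](_ : _ = 3 * a * (3 * Y) ^+ e); last by rewrite exprMn exprS; ring.
  apply: ler_pM; rewrite ?exprn_ge0//; try lra.
  by rewrite lerXn2r ?nnegrE; lra.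
Qed.
End PowerSums.

(** * Multiplicities *)

Lemma ffact_bounds k m : (k.+1 ^ m <= (k + m) ^_ m <= (k + m) ^ m)%N.
Proof.
elim: m => [|m /andP[IH1 IH2]]; first by rewrite !expn0 ffactn0.
rewrite addnS ffactnS /= !expnS; apply/andP; split.
  by rewrite leq_mul// ltnS leq_addr.
rewrite leq_mul//; apply: leq_trans IH2 _.
by case: m {IH1} => // m; rewrite leq_exp2r.
Qed.

Section Dimension.
Variable R : realType.

(** With [n = 2 k + q - 1] and [m = q - 2], the binomial coefficient is the
    product [(k+1) ... (k+m)] divided by [m!], and both this product and
    [(n/2)^m] lie between [(k+1)^m] and [(k+m)^m], which differ by
    [O(n^(m-1))]. *)
Lemma harmonic_dim_estimate m k : (0 < m)%N ->
  `|harmonic_dim R m.+2 k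
    - (2 * k + m + 1)%:R ^+ m.+1 / (2 ^+ m * m.+1`!%:R)|
  <= (m ^ 2)%:R * (2 * k + m + 1)%:R ^+ m.
Proof.
case: m => // m _; set n := (2 * k + m.+1 + 1)%N.
rewrite /harmonic_dim (_ : (2 * k + m.+3 - 1)%N = n); last by rewrite /n; lia.
rewrite (_ : (m.+3 - 1)%N = m.+2); last by lia.
rewrite (_ : (k + m.+3 - 2)%N = (k + m.+1)%N); last by lia.
have -> : 'C(k + m.+1, k) = 'C(k + m.+1, m.+1).
  by rewrite -bin_sub ?leq_addr// addKn.
set b := 'C(_, _).
have bE : (b%:R * m.+1`!%:R = ((k + m.+1) ^_ m.+1)%:R :> R).
  by rewrite -natrM bin_ffact.
have f1 : 0 < m.+1`!%:R :> R by rewrite ltr0n fact_gt0.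
have n0 : 0 <= n%:R :> R by [].
have m0 : 0 <= m%:R :> R by [].
have k0 : 0 <= k%:R :> R by [].
have nE : n%:R = 2 * k%:R + m%:R + 2 :> R by rewrite (_ : n = 2 * k + (m + 2))%N ?natrD ?natrM; [ring|rewrite /n; lia].
have kS : k.+1%:R = k%:R + 1 :> R by rewrite natr1.
have kmE : (k + m.+1)%:R = k%:R + m%:R + 1 :> R by rewrite addnS -natr1 natrD.
have [lo up] := andP (ffact_bounds k m.+1).
have key : `|b%:R * m.+1`!%:R - (n%:R / 2) ^+ m.+1|
    <= m.+1%:R * m.+1%:R * n%:R ^+ m :> R.
  apply: (@le_trans _ _ ((k + m.+1)%:R ^+ m.+1 - k.+1%:R ^+ m.+1 : R)).
    rewrite bE; move: lo up; rewrite -(ler_nat R) -[(_ <= _ ^ _)%N](ler_nat R).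
    rewrite !natrX => lo up.
    have : (k.+1%:R : R) ^+ m.+1 <= (n%:R / 2) ^+ m.+1.
      by rewrite lerXn2r ?nnegrE//; lra.
    have : (n%:R / 2) ^+ m.+1 <= (k + m.+1)%:R ^+ m.+1 :> R.
      by rewrite lerXn2r ?nnegrE//; lra.
    by move=> h1 h2; rewrite ler_norml; apply/andP; split; lra.
  apply: le_trans (exprB_le _ _) _; first by rewrite ler0n ler_nat; lia.
  rewrite -!mulrA; apply: ler_wpM2l => //; apply: ler_pM => //.
  - by rewrite subr_ge0 ler_nat; lia.
  - by rewrite kmE kS -natr1; lra.
  - by rewrite lerXn2r ?nnegrE// ler_nat /n; lia.
rewrite [X in `|X|](_ : _ = n%:R / m.+2`!%:R *
    (b%:R * m.+1`!%:R - (n%:R / 2) ^+ m.+1)); last first.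
  rewrite (factS m.+1) natrM expr_div_n [n%:R ^+ m.+2]exprS.
  field; rewrite lt0r_neq0//= -?exprS ?lt0r_neq0 ?exprn_gt0 ?ltr0n ?fact_gt0//=.
rewrite normrM ger0_norm ?divr_ge0//.
apply: (@le_trans _ _ (n%:R * (m.+1%:R * m.+1%:R * n%:R ^+ m))).
  apply: ler_pM => //.
  by rewrite ler_pdivrMr ?ltr0n ?fact_gt0// ler_peMr// ler1n fact_gt0.
by rewrite exprS natrX; lra.
Qed.

(** For [q = 2 h + 2] a mode [(+-j, k)] is encoded by [i] and [j] where
    [k + h = i + j]; then [n = 2 k + q - 1 = 2 (i + j) + 1], and [n - 2 j] and
    [n + 2 j] are the two factors below.  Their product is
    [n^2 - 4 j^2], so the inequality says that the eigenvalue is negative. *)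
Definition beyond_cone (h i j : nat) : bool :=
  ((2 * h + 1) ^ 2 < (2 * i + 1) * (2 * i + 1 + 4 * j))%N.

(** The two factors have arithmetic mean [n], so [n > q - 1], that is [k > 0];
    the truncated difference [i + j - h] is therefore exact. *)
Lemma beyond_cone_leq h i j : beyond_cone h i j -> (h <= i + j)%N.
Proof. rewrite /beyond_cone; nia. Qed.

Definition mode_dim h i j : R :=
  if beyond_cone h i j then harmonic_dim R (2 * h + 2) (i + j - h) else 0.

(** The pairs outside [beyond_cone] are also covered: there
    [n <= (n - 2 j) (n + 2 j) <= (q - 1)^2], so the leading term is already of
    the order of the error and the constraint costs nothing. *)
Lemma mode_dim_estimate h i j : (0 < h)%N ->
  `|mode_dim h i j
    - (2 * i + 1 + 2 * j)%:R ^+ (2 * h + 1) / (2 ^+ (2 * h) * (2 * h + 1)`!%:R)|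
  <= ((2 * h + 1) ^ 2)%:R * (2 * i + 1 + 2 * j)%:R ^+ (2 * h).
Proof.
move=> h0; rewrite /mode_dim; case: ifPn => [/beyond_cone_leq hij|].
  have := @harmonic_dim_estimate (2 * h) (i + j - h) ltac:(lia).
  rewrite (_ : 2 * (i + j - h) + 2 * h + 1 = 2 * i + 1 + 2 * j)%N; last by lia.
  rewrite -(addn2 (2 * h)) -(addn1 (2 * h)) => /le_trans; apply; apply: ler_wpM2r => //.
  by rewrite ler_nat; lia.
rewrite /beyond_cone -leqNgt => ab.
rewrite sub0r normrN ger0_norm ?divr_ge0 ?mulr_ge0// ?exprn_ge0//.
rewrite ler_pdivrMr ?mulr_gt0 ?exprn_gt0 ?ltr0n ?fact_gt0// (addn1 (2 * h)) exprS.
rewrite -[leLHS]mulr1; apply: ler_pM; rewrite ?mulr_ge0 ?exprn_ge0//.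
  by apply: ler_wpM2r; [exact: exprn_ge0|rewrite ler_nat; nia].
by rewrite mulr_ege1 ?exprn_ege1 ?ler1n ?fact_gt0.
Qed.
End Dimension.

(** * The zeta series over odd integers *)

Section Zeta.
Variable R : realType.

Lemma sum_invsq_le2 L : \sum_(i < L) (i.+1%:R ^+ 2)^-1 <= 2 :> R.
Proof.
case: L => [|L]; first by rewrite big_ord0.
apply: (@le_trans _ _ (2 - L.+1%:R^-1)); last by rewrite gerBl invr_ge0.
elim: L => [|L IH]; first by rewrite big_ord_recr big_ord0 /=; lra.
rewrite big_ord_recr /=; apply: le_trans (lerD IH (lexx _)) _.
rewrite -[L.+2%:R]natr1; set x : R := L.+1%:R.
have x0 : 0 < x by rewrite ltr0n.
rewrite -subr_ge0 [X in 0 <= X](_ : _ = (x * (x + 1) ^+ 2)^-1); last first.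
  by field; rewrite !gt_eqF//; lra.
by rewrite invr_ge0 mulr_ge0 ?exprn_ge0//; lra.
Qed.

Variable q : nat.
Hypothesis q_ge2 : (2 <= q)%N.

Lemma invX_le_invsq (x : R) : 1 <= x -> (x ^+ q)^-1 <= (x ^+ 2)^-1.
Proof.
move=> x1; rewrite lef_pV2 ?posrE ?exprn_gt0//; try lra.
exact: ler_weXn2l.
Qed.

Lemma zetaE :
  zeta q%:R = limn (fun m => \sum_(i < m.-1) (i.+1%:R ^+ q)^-1 : R).
Proof.
rewrite /zeta; set u := (X in limn X); set v := (X in _ = limn X).
suff -> : u = v by [].
apply/funext => -[|m]; rewrite /u /v; first by rewrite big_geq// big_ord0.
rewrite big_add1 big_mkord; apply: eq_bigr => i _.
by rewrite powRN powR_mulrn.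
Qed.

Lemma cvg_zeta : (fun m => \sum_(i < m) (i.+1%:R ^+ q)^-1) @ \oo --> (zeta q%:R : R).
Proof.
have cv : cvgn (fun m => \sum_(i < m) ((i.+1%:R : R) ^+ q)^-1).
  apply: nondecreasing_is_cvgn.
    apply/nondecreasing_seqP => m.
    by rewrite big_ord_recr /= lerDl invr_ge0 exprn_ge0.
  exists 2 => _ [m _ <-]; apply: le_trans (sum_invsq_le2 m).
  by apply: ler_sum => i _; apply: invX_le_invsq; rewrite ler1n.
rewrite zetaE (_ : limn _ = limn (fun m => \sum_(i < m) ((i.+1%:R : R) ^+ q)^-1)) //.
apply: cvg_lim => //; rewrite -(cvg_shiftS (fun m => \sum_(i < m.-1) _)); exact: cv.
Qed.

(** Splitting the integers up to [2 m] by parity, the even ones contribute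
    [2^-q] times the partial sum up to [m]. *)
Lemma cvg_odd_zeta :
  (fun m => \sum_(i < m) ((2 * i + 1)%:R ^+ q)^-1) @ \oo
    --> ((1 - (2 ^+ q)^-1) * zeta q%:R : R).
Proof.
have -> : (fun m => \sum_(i < m) ((2 * i + 1)%:R ^+ q)^-1) =
  (fun m => \sum_(i < 2 * m) (i.+1%:R ^+ q)^-1
     - (2 ^+ q)^-1 * \sum_(i < m) (i.+1%:R ^+ q)^-1 : R).
  apply/funext; elim => [|m IH]; first by rewrite !big_ord0 mulr0 subr0.
  rewrite [LHS]big_ord_recr /= IH.
  rewrite (_ : 2 * m.+1 = (2 * m).+2)%N; last by lia.
  rewrite [in RHS]big_ord_recr [in RHS]big_ord_recr /= [in RHS]big_ord_recr /=.
  rewrite mulrDr -invfM -exprMn -natrM addn1.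
  rewrite (_ : (2 * m).+2 = 2 * m.+1)%N; last by lia.
  by lra.
rewrite mulrBl mul1r; apply: cvgB.
  apply: (cvg_comp (fun m => 2 * m)%N _ _ cvg_zeta).
  by apply/cvgnyPge => A; exists A => // n /=; lia.
by apply: cvgMl_tmp; exact: cvg_zeta.
Qed.
End Zeta.

(** * From eigenvalues to pairs of factors *)

Section Modes.
Variable R : realType.

Lemma esum_box L (P : nat -> nat -> bool) (F : nat -> nat -> R) :
  (forall i j, P i j -> (i < L)%N && (j < L)%N) ->
  (forall i j, 0 <= F i j) ->
  \esum_(ij in [set ij | P ij.1 ij.2]) (F ij.1 ij.2)%:E
    = (\sum_(i < L) \sum_(j < L) if P i j then F i j else 0)%:E.
Proof.
move=> PL F0; pose r := [seq (i, j) | i <- iota 0 L, j <- iota 0 L].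
have ur : uniq r by apply: allpairs_uniq; rewrite ?iota_uniq// => -[? ?] [? ?].
have Pr ij : P ij.1 ij.2 -> ij \in r.
  case: ij => i j /= /PL /andP[iL jL]; apply/allpairsP; exists (i, j).
  by rewrite !mem_iota.
rewrite esum_fset; last by move=> ij _; rewrite lee_fin.
  rewrite (fsbigE [seq ij <- r | P ij.1 ij.2]) ?filter_uniq//.
  - rewrite big_filter_cond /=.
    rewrite [LHS](_ : _ = \sum_(ij <- r) (if P ij.1 ij.2 then F ij.1 ij.2 else 0)%:E)%E.
      rewrite sumEFin; congr EFin; rewrite /r big_allpairs_dep /=.
      rewrite -(big_mkord xpredT (fun i => \sum_(j < L) if P i j then F i j else 0)).
      rewrite /index_iota subn0; apply: eq_bigr => i _.
      by rewrite -(big_mkord xpredT (fun j => if P i j then F i j else 0)) /index_iota subn0.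
    rewrite big_mkcond; apply: eq_bigr => ij _.
    by case E: (P _ _) => //=; rewrite mem_set.
  - by move=> ij /=; rewrite mem_filter => /andP[].
  - by move=> ij /= Pij; rewrite mem_filter Pij Pr.
apply: (sub_finite_set (B := [set` r])); last exact: finite_seq.
by move=> ij /= /Pr.
Qed.

Definition mode_pairs h (s : R) : set (nat * nat) :=
  [set ij | beyond_cone h ij.1 ij.2 &&
    (((2 * ij.1 + 1) * (2 * ij.1 + 1 + 4 * ij.2))%:R
       <= 4 * s + (2 * h + 1)%:R ^+ 2)].

(** Completing the square, [4 k (k + q - 1) = n^2 - (q - 1)^2], so four times
    the eigenvalue is [(q - 1)^2 - (n - 2|z|) (n + 2|z|)]. *)
Lemma neg_modesE h s (z : int) (i k : nat) : (k + h = i + absz z)%N ->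
  neg_modes (2 * h + 2) s (z, k) <-> mode_pairs h s (i, absz z).
Proof.
move=> khE; have ev : 4 * box_eigenvalue (2 * h + 2) z k =
    ((2 * h + 1) ^ 2)%N%:Z - ((2 * i + 1) * (2 * i + 1 + 4 * absz z))%N%:Z.
  rewrite /box_eigenvalue (_ : (k + (2 * h + 2) - 1 = k + 2 * h + 1)%N); last by lia.
  rewrite -[z ^+ 2]real_normK ?num_real// -abszE.
  have kE : k%:Z = i%:Z + (absz z)%:Z - h%:Z by lia.
  rewrite -mulnn !(PoszM, PoszD) kE; ring.
rewrite /neg_modes /mode_pairs /= /beyond_cone.
have evR : 4 * (box_eigenvalue (2 * h + 2) z k)%:~R =
   (2 * h + 1)%:R ^+ 2 - ((2 * i + 1) * (2 * i + 1 + 4 * absz z))%:R :> R.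
  have /(congr1 (intr : int -> R)) := ev.
  move: (box_eigenvalue _ _ _) => b.
  by rewrite intrM intrB rmorph_nat -natrX -!pmulrn.
split.
  by case=> e1 e2; apply/andP; split; [lia|lra].
by move=> /andP[e1 e2]; split; [lra|lia].
Qed.

Lemma neg_mode_freq_le h (z : int) k :
  box_eigenvalue (2 * h + 2) z k < 0 -> (absz z <= k + h)%N.
Proof.
rewrite /box_eigenvalue (_ : (k + (2 * h + 2) - 1 = k + 2 * h + 1)%N); last by lia.
rewrite -[z ^+ 2]real_normK ?num_real// -abszE subr_lt0.
rewrite -[_ ^+ 2]/(_%:Z * _%:Z) -PoszM ltz_nat; nia.
Qed.

(** Both factors are at least 1, hence at most their product: a bounded
    spectral window contains finitely many modes, although the cone
    [n = 2 |j|] which bounds their region is infinite. *)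
Lemma mode_pairs_bound h s L ij : 4 * s + (2 * h + 1)%:R ^+ 2 < L%:R ->
  mode_pairs h s ij -> (ij.1 < L)%N && (ij.2 < L)%N.
Proof.
case: ij => i j /= XL /andP[_ /le_lt_trans/(_ XL)]; rewrite ltr_nat /= => lt_abL.
have := @leq_pmulr (2 * i + 1) (2 * i + 1 + 4 * j) ltac:(lia).
have := @leq_pmull (2 * i + 1 + 4 * j) (2 * i + 1) ltac:(lia).
lia.
Qed.

Lemma harmonic_dim_ge0 q k : 0 <= harmonic_dim R q k.
Proof. by rewrite /harmonic_dim mulr_ge0// divr_ge0. Qed.

(** Nonnegative and negative frequencies are each in bijection with pairs
    [(i, j)], the latter with [0 < j]; together they give the weight
    [freq_mult j]. The cutoff [L] is free, which allows [L] to tend to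
    infinity later while the left-hand side stays fixed. *)
Lemma Nminus_finsum h s L : 4 * s + (2 * h + 1)%:R ^+ 2 < L%:R ->
  Nminus (2 * h + 2) s =
  (\sum_(i < L) \sum_(j < L | ((2 * i + 1) * (2 * i + 1 + 4 * j))%:R
       <= 4 * s + (2 * h + 1)%:R ^+ 2)
     (freq_mult j)%:R * mode_dim R h i j)%:E.
Proof.
move=> XL; set q := (2 * h + 2)%N.
have dim0 k := harmonic_dim_ge0 q k.
rewrite /Nminus (esumID [set jk | 0 <= jk.1]); last first.
  by move=> jk _; rewrite lee_fin.
have bij1 : set_bij (mode_pairs h s)
   (neg_modes q s `&` [set jk : int * nat | 0 <= jk.1])
   (fun ij => (ij.2%:Z, ij.1 + ij.2 - h)%N).
  split.
  - move=> [i j] /= Bij; split => //.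
    have /andP[/beyond_cone_leq /= hij _] := Bij.
    have kE : (i + j - h + h = i + absz j)%N by lia.
    by apply/(neg_modesE s kE).
  - move=> [i j] [i' j']; rewrite !inE.
    move=> /andP[/beyond_cone_leq/= e1 _] /andP[/beyond_cone_leq/= e2 _] [? ?].
    by congr (_, _); lia.
  - move=> [z k] [/= Nzk z0].
    have zk : (absz z <= k + h)%N by case: Nzk => _ /neg_mode_freq_le.
    exists (k + h - absz z, absz z)%N; last by congr (_, _) => /=; lia.
    have kE : (k + h = k + h - absz z + absz z)%N by lia.
    by apply/(neg_modesE s kE).
have bij2 : set_bij (mode_pairs h s `&` [set ij | (0 < ij.2)%N])
   (neg_modes q s `&` ~` [set jk : int * nat | 0 <= jk.1])
   (fun ij => (- ij.2%:Z, ij.1 + ij.2 - h)%N).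
  split.
  - move=> [i j] /= [Bij j0]; split; last by lia.
    have /andP[/beyond_cone_leq /= hij _] := Bij.
    have kE : (i + j - h + h = i + absz (- j%:Z))%N by lia.
    by apply/(neg_modesE s kE); rewrite abszN.
  - move=> [i j] [i' j']; rewrite !inE => -[+ _] [+ _].
    move=> /andP[/beyond_cone_leq/= e1 _] /andP[/beyond_cone_leq/= e2 _] [? ?].
    by congr (_, _); lia.
  - move=> [z k] [/= Nzk z0].
    have zk : (absz z <= k + h)%N by case: Nzk => _ /neg_mode_freq_le.
    exists (k + h - absz z, absz z)%N; last by congr (_, _) => /=; lia.
    split; last by rewrite /=; lia.
    have kE : (k + h = k + h - absz z + absz z)%N by lia.
    by apply/(neg_modesE s kE).
rewrite (reindex_esum _ _ _ _ bij1) (reindex_esum _ _ _ _ bij2) /=.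
pose P i j := beyond_cone h i j &&
  (((2 * i + 1) * (2 * i + 1 + 4 * j))%:R <= 4 * s + (2 * h + 1)%:R ^+ 2).
have PL i j : P i j -> (i < L)%N && (j < L)%N.
  by move=> Pij; apply: (mode_pairs_bound (ij := (i, j)) XL).
rewrite (esum_box (P := P) (F := fun i j => harmonic_dim R q (i + j - h)) PL)//.
pose P' i j := P i j && (0 < j)%N.
have P'L i j : P' i j -> (i < L)%N && (j < L)%N by move=> /andP[/PL].
rewrite (_ : mode_pairs h s `&` _ = [set ij | P' ij.1 ij.2]); last first.
  by apply/seteqP; split => -[i j] /= => [[Pij j0]|/andP[]//]; apply/andP.
rewrite (esum_box (P := P') (F := fun i j => harmonic_dim R q (i + j - h)) P'L)//.
rewrite -EFinD; congr EFin; rewrite -big_split; apply: eq_bigr => i _.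
rewrite -big_split [RHS]big_mkcond; apply: eq_bigr => j _ /=.
rewrite /P' /P /mode_dim /freq_mult; case: beyond_cone; case: (_ <= _) => //=.
- by case: (0 < j)%N; rewrite ?addr0 ?mul1r// mulr_natl mulr2n.
- by rewrite addr0.
- by rewrite mulr0 addr0.
- by rewrite addr0.
Qed.

End Modes.

(** * Summation over the rows *)

Section Assembly.
Variables (R : realType) (h : nat).
Hypothesis h_gt0 : (0 < h)%N.

Let dim_coef : R := (2 ^+ (2 * h) * (2 * h + 1)`!%:R)^-1.
Let row_err : R := (((2 * h + 1) ^ 2)%:R + 1) * 3 ^+ (2 * h).+2.

Lemma row_err_ge0 : 0 <= row_err.
Proof. by rewrite /row_err mulr_ge0 ?addr_ge0 ?exprn_ge0. Qed.

(** The row of [a = 2 i + 1] with [Y = X / a]: the error of [row_estimate] is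
    [O(a Y^(q-1)) = O(X^(q-1) / a^(q-2))], and [q - 2 >= 2] makes it summable
    over [a].  This is where dimension 2 would bring in a logarithm. *)
Lemma row_total (X : R) i L : 0 <= X < L%:R ->
  `|\sum_(j < L | ((2 * i + 1) * (2 * i + 1 + 4 * j))%:R <= X)
       (freq_mult j)%:R * mode_dim R h i j
    - dim_coef * (X / 2) ^+ (2 * h).+2 / (2 * h).+2%:R / (2 * i + 1)%:R ^+ (2 * h).+2|
  <= row_err * X ^+ (2 * h).+1 * ((2 * i + 1)%:R ^+ 2)^-1.
Proof.
case/andP=> X0 XL; set a : R := (2 * i + 1)%:R; set Y := X / a.
have a1 : 1 <= a by rewrite ler1n addn1.
have a0 : 0 < a by lra.
have Y0 : 0 <= Y by rewrite divr_ge0// ltW.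
have YL : Y < L%:R by apply: le_lt_trans XL; rewrite ler_pdivrMr// ler_peMr.
have c0 : 0 <= dim_coef by rewrite invr_ge0 mulr_ge0// exprn_ge0.
have c1 : dim_coef <= 1.
  rewrite invf_le1 ?mulr_gt0 ?exprn_gt0 ?ltr0n ?fact_gt0//.
  by rewrite mulr_ege1 ?exprn_ege1 ?ler1n ?fact_gt0//; lra.
have condE j : (((2 * i + 1) * (2 * i + 1 + 4 * j))%:R <= X)
    = (a + 4 * j%:R <= Y).
  by rewrite ler_pdivlMr// natrM (natrD _ (2 * i + 1)) (natrM _ 4) -/a mulrC.
rewrite (eq_bigl _ _ (fun j : 'I_L => condE j)).
have Ya : a * Y ^+ (2 * h).+1 <= X ^+ (2 * h).+1 * (a ^+ 2)^-1.
  rewrite /Y expr_div_n mulrCA; apply: ler_wpM2l; first exact: exprn_ge0.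
  rewrite exprS invfM mulrA divff ?mul1r ?gt_eqF//.
  rewrite lef_pV2 ?posrE ?exprn_gt0//; apply: ler_weXn2l => //; lia.
have rowB := row_bound (2 * h) a1 (introT andP (conj Y0 YL)).
have rowE := row_estimate (2 * h).+1 a1 (introT andP (conj Y0 YL)).
set S1 := \sum_(j < L | _) _ in rowB.
set S2 := \sum_(j < L | _) _ in rowE.
rewrite [X in `|X|](_ : _ =
   \sum_(j < L | a + 4 * j%:R <= Y) (freq_mult j)%:R *
      (mode_dim R h i j - dim_coef * (a + 2 * j%:R) ^+ (2 * h).+1)
   + dim_coef * (S2 - (Y / 2) ^+ (2 * h).+2 / (2 * h).+2%:R)); last first.
  rewrite mulrBr addrA; congr (_ - _).
    rewrite /S2 mulr_sumr -big_split; apply: eq_bigr => j _ /=; ring.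
  have h0 : 0 <= h%:R :> R by [].
  rewrite /Y !expr_div_n; field.
  by apply/and3P; split; rewrite ?expf_neq0 ?gt_eqF//; lra.
apply: le_trans (ler_normD _ _) _.
have dimD : `|\sum_(j < L | a + 4 * j%:R <= Y) (freq_mult j)%:R *
      (mode_dim R h i j - dim_coef * (a + 2 * j%:R) ^+ (2 * h).+1)|
    <= ((2 * h + 1) ^ 2)%:R * S1.
  apply: le_trans (ler_norm_sum _ _ _) _; rewrite mulr_sumr; apply: ler_sum => j _.
  rewrite normrM ger0_norm// mulrCA; apply: ler_wpM2l => //.
  have := mode_dim_estimate R i j h_gt0.
  by rewrite natrD natrM -/a mulrC -/dim_coef addn1.
have aY0 : 0 <= a * Y ^+ (2 * h).+1 by rewrite mulr_ge0 ?exprn_ge0// ltW.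
have part1 : ((2 * h + 1) ^ 2)%:R * S1
    <= ((2 * h + 1) ^ 2)%:R * (3 ^+ (2 * h).+2 * (a * Y ^+ (2 * h).+1)).
  apply: ler_wpM2l => //; apply: le_trans rowB _.
  apply: ler_pM; rewrite ?exprn_ge0//; first by apply: ler_weXn2l => //; lra.
  by rewrite ler_peMl ?exprn_ge0.
have part2 : `|dim_coef * (S2 - (Y / 2) ^+ (2 * h).+2 / (2 * h).+2%:R)|
   <= 3 ^+ (2 * h).+2 * (a * Y ^+ (2 * h).+1).
  rewrite normrM ger0_norm// -[leRHS]mul1r; exact: ler_pM.
apply: le_trans (lerD (le_trans dimD part1) part2) _.
rewrite [leLHS](_ : _ = row_err * (a * Y ^+ (2 * h).+1)); last by rewrite /row_err; ring.
rewrite -[leRHS]mulrA; apply: ler_wpM2l => //.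
exact: row_err_ge0.
Qed.

Lemma mode_sum_estimate (X : R) L : 0 <= X < L%:R ->
  `|\sum_(i < L) \sum_(j < L | ((2 * i + 1) * (2 * i + 1 + 4 * j))%:R <= X)
       (freq_mult j)%:R * mode_dim R h i j
    - dim_coef * (X / 2) ^+ (2 * h).+2 / (2 * h).+2%:R
      * \sum_(i < L) ((2 * i + 1)%:R ^+ (2 * h).+2)^-1|
  <= 2 * row_err * X ^+ (2 * h).+1.
Proof.
move=> XL; have [X0 _] := andP XL.
rewrite mulr_sumr -sumrB; apply: le_trans (ler_norm_sum _ _ _) _.
apply: (@le_trans _ _ (\sum_(i < L) row_err * X ^+ (2 * h).+1 * (i.+1%:R ^+ 2)^-1)).
  apply: ler_sum => i _; apply: le_trans (row_total i XL) _.
  apply: ler_wpM2l; first by rewrite mulr_ge0 ?row_err_ge0 ?exprn_ge0.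
  rewrite lef_pV2 ?posrE ?exprn_gt0 ?ltr0n//; last by lia.
  by rewrite lerXn2r ?nnegrE// ler_nat; lia.
rewrite -mulr_sumr -[2 * row_err * _]mulrA [leRHS]mulrC; apply: ler_wpM2l.
  by rewrite mulr_ge0 ?row_err_ge0 ?exprn_ge0.
exact: sum_invsq_le2.
Qed.

Lemma Nminus_estimate (s : R) : 0 <= s ->
  `|fine (Nminus (2 * h + 2) s) -
     dim_coef * ((4 * s + (2 * h + 1)%:R ^+ 2) / 2) ^+ (2 * h).+2 / (2 * h).+2%:R
       * ((1 - (2 ^+ (2 * h).+2)^-1) * zeta (2 * h).+2%:R)|
  <= 2 * row_err * (4 * s + (2 * h + 1)%:R ^+ 2) ^+ (2 * h).+1.
Proof.
move=> s0; set X := 4 * s + _.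
have X0 : 0 <= X by rewrite addr_ge0 ?mulr_ge0 ?exprn_ge0.
pose L0 := (Num.truncn X).+1.
have XL L : (L0 <= L)%N -> X < L%:R.
  move=> LL; apply: (@lt_le_trans _ _ L0%:R); first exact: truncnS_gt.
  by rewrite ler_nat.
set B := leRHS.
have cvN := @cvg_odd_zeta R (2 * h).+2 isT.
apply: (cvgr_to_le (cvg_norm (cvgB (cvg_cst _) (cvgMl_tmp cvN)))).
exists L0 => // L /= LL.
rewrite (Nminus_finsum (XL _ LL)) /=; apply: mode_sum_estimate.
by rewrite X0 XL.
Qed.

(** Taking out the factor 4 of [X = 4 s + (q - 1)^2] makes the constant of the
    asymptotics appear. *)
Lemma weyl_coefE (X : R) :
  dim_coef * (X / 2) ^+ (2 * h).+2 / (2 * h).+2%:R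
    = 4 / (2 * h).+2`!%:R * (X / 4) ^+ (2 * h).+2.
Proof.
rewrite /dim_coef addn1 (factS (2 * h).+1) natrM (_ : X / 2 = 2 * (X / 4)); last by lra.
rewrite [(2 * _) ^+ _]exprMn [2 ^+ _.+2]exprS [2 ^+ _.+1]exprS.
set p := 2 ^+ (2 * h); set f := ((2 * h).+1)`!%:R.
have p0 : p != 0 by rewrite expf_neq0.
have f0 : f != 0 by rewrite pnatr_eq0 -lt0n fact_gt0.
have n0 : ((2 * h).+2%:R : R) != 0 by rewrite pnatr_eq0.
by move: (_ ^+ _) (_.+2%:R) n0 => Z n n0; field; apply/and3P.
Qed.

Lemma Nminus_asymptotic :
  exists C : R, forall s, 1 <= s ->
  `|fine (Nminus (2 * h + 2) s) -
     4 / (2 * h).+2`!%:R * ((1 - (2 ^+ (2 * h).+2)^-1) * zeta (2 * h).+2%:R)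
       * s ^+ (2 * h).+2|
  <= C * s ^+ (2 * h).+1.
Proof.
set D : R := (2 * h + 1)%:R ^+ 2; set A := 4 / _ * _.
have D0 : 0 <= D by rewrite exprn_ge0.
exists (2 * row_err * (4 * (1 + D)) ^+ (2 * h).+1
  + `|A| * ((2 * h).+2%:R * D * (1 + D) ^+ (2 * h).+1)) => s s1.
have s0 : 0 <= s by lra.
have := Nminus_estimate s0; rewrite -/D weyl_coefE mulrAC -/A.
set X := 4 * s + D; set N := fine _ => est.
have Ds : D <= D * s by rewrite ler_peMr.
have X0 : 0 <= X by rewrite /X; lra.
have Xs : X <= 4 * (1 + D) * s by rewrite /X; lra.
rewrite (_ : N - _ = (N - A * (X / 4) ^+ (2 * h).+2)
   + A * ((X / 4) ^+ (2 * h).+2 - s ^+ (2 * h).+2)); last by ring.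
apply: le_trans (ler_normD _ _) _; rewrite [leRHS]mulrDl; apply: lerD.
  apply: le_trans est _; rewrite -[leRHS]mulrA -exprMn.
  apply: ler_wpM2l; first by rewrite mulr_ge0 ?row_err_ge0.
  by rewrite lerXn2r ?nnegrE//; lra.
rewrite normrM -[leRHS]mulrA; apply: ler_wpM2l => //.
have sX : 0 <= s <= X / 4 by rewrite /X; lra.
rewrite ger0_norm; last first.
  by rewrite subr_ge0 lerXn2r ?nnegrE//; lra.
apply: le_trans (exprB_le _ sX) _; rewrite -[leRHS]mulrA -exprMn.
apply: ler_pM; rewrite ?mulr_ge0 ?exprn_ge0//; try lra.
  by apply: ler_wpM2l => //; rewrite /X; lra.
by rewrite lerXn2r ?nnegrE//; lra.
Qed.
End Assembly.

Theorem theorem5p3 (R : realType) (q : nat) (q_ge4 : (4 <= q)%N)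
    (q_even : ~~ odd q) :
  (forall s : R, Nminus q s \is a fin_num) /\
  (fun s : R => fine (Nminus q s)) =
    (fun s : R => 4 / q`!%:R * (1 - (2 ^+ q)^-1) * zeta q%:R * s ^+ q)
    +O_ (pinfty_nbhs R) (fun s : R => s ^+ (q - 1)).
Proof.
have [h h0 ->] : exists2 h, (0 < h)%N & q = (2 * h + 2)%N.
  by exists (q./2.-1); lia.
split=> [s|].
  have := truncnS_gt (4 * s + (2 * h + 1)%:R ^+ 2).
  by move=> /Nminus_finsum ->.
have [C estC] := Nminus_asymptotic R h0.
apply/eqaddOP; exists C; split; first exact: num_real.
move=> k Ck; exists 1; split; first exact: num_real.
move=> s s1; have := estC s (ltW s1).
rewrite (_ : (2 * h + 2 - 1 = (2 * h).+1)%N); last by lia.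
rewrite addn2 !fctE -[4 / _ * _ * zeta _]mulrA => /le_trans; apply.
rewrite ger0_norm ?exprn_ge0//; last by lra.
by apply: ler_wpM2r; [rewrite exprn_ge0//; lra|exact: ltW].
Qed.
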